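(* For all $n\geq 3$, the standard filiform Lie algebra $L_n$ possesses an inner product relative to which $L_n$ has a totally geodesic subalgebra of codimension two.
   Context: All Lie algebras are finite-dimensional and over $\mathbb R$. The standard filiform algebra $L_n$ is the $n$-dimensional real Lie algebra with basis $\{X_1,\dots,X_n\}$ whose only nonzero relations (up to antisymmetry) are $[X_1,X_i]=X_{i+1}$ for $i=2,\dots,n-1$. A metric Lie algebra is a Lie algebra $\mathfrak g$ equipped with an inner product $\langle\cdot,\cdot\rangle$ (arbitrary; no compatibility with the bracket is assumed). Its Levi-Civita connection $\nabla$ is the bilinear map $\mathfrak g\times\mathfrak g\to\mathfrak g$ given by $2\langle\nabla_XY,Z\rangle=\langle[X,Y],Z\rangle+\langle[Z,X],Y\rangle+\langle[Z,Y],X\rangle$ for all $X,Y,Z\in\mathfrak g$. A subalgebra $\mathfrak h$ of $\mathfrak g$ is totally geodesic if $\nabla_YZ\in\mathfrak h$ for all $Y,Z\in\mathfrak h$. *)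

(* Defs.v *)
From HB Require Import structures.
From mathcomp Require Import all_boot all_order all_algebra.
From mathcomp Require Import boolp classical_sets reals.
From mathcomp Require Import ring.

Set Implicit Arguments.
Unset Strict Implicit.
Unset Printing Implicit Defensive.

Import Order.TTheory GRing.Theory Num.Theory.
Local Open Scope ring_scope.

HB.mixin Record Vector_isLieAlgebra (R : fieldType) L of Vector R L := {
  lie : L -> L -> L;
  lie_linearl : forall y, linear (lie ^~ y);
  lie_linearr : forall x, linear (lie x);
  lie_alternating : forall x, lie x x = 0;
  lie_jacobi : forall x y z,
    lie x (lie y z) + lie y (lie z x) + lie z (lie x y) = 0
}.

#[short(type="lieAlgType")]
HB.structure Definition LieAlgebra (R : fieldType) :=
  { L of Vector_isLieAlgebra R L & Vector R L }.

HB.instance Definition _ (R : fieldType) (L : lieAlgType R) :=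
  bilinear_isBilinear.Build R L L L *:%R *:%R (@lie R L)
    (@lie_linearl R L, @lie_linearr R L).

Lemma lieC (R : fieldType) (L : lieAlgType R) (x y : L) : lie y x = - lie x y.
Proof.
have := lie_alternating (x + y).
rewrite linearDl /= !linearDr /= !lie_alternating add0r addr0 addrC => /eqP.
by rewrite addr_eq0 => /eqP.
Qed.

Definition is_subalgebra (R : fieldType) (L : lieAlgType R) (h : {vspace L}) :=
  forall x y, x \in h -> y \in h -> lie x y \in h.

Section LeviCivita.
Variables (R : realFieldType) (L : lieAlgType R).
Variable g : {dot L for idfun}.

(* {dot L for idfun} is the library's type of symmetric, positive definite
   bilinear forms: with theta := idfun no conjugation is involved. *)
Definition koszul (x y z : L) : R :=
  g (lie x y) z + g (lie z x) y + g (lie z y) x.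

(* By levi_civitaP and levi_civita_unique below, there is exactly one such w,
   so the default value 0 of xget is never used. *)
Definition levi_civita (x y : L) : L :=
  xget 0 [set w | forall z, 2 * g w z = koszul x y z]%classic.

Definition totally_geodesic (h : {vspace L}) :=
  forall y z, y \in h -> z \in h -> levi_civita y z \in h.

Lemma dot_eq0 (v : L) : g v v = 0 -> v = 0.
Proof.
move=> gv; apply/eqP; apply: contraT => vN0.
by have := @neq0_dnorm_gt0 _ _ _ g v vN0; rewrite gv ltxx.
Qed.

Lemma dot_inj (v w : L) : (forall z, g v z = g w z) -> v = w.
Proof.
move=> vw; apply/eqP; rewrite -subr_eq0; apply/eqP/dot_eq0.
by rewrite linearBl /= vw subrr.
Qed.

Lemma dot_riesz (f : {scalar L}) : exists w, forall z, g w z = f z.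
Proof.
pose b := vbasis {:L}.
have bP : basis_of fullv b by exact: vbasisP.
pose F (w : L) := \sum_(i < \dim {:L}) g w b`_i *: b`_i.
have FL : linear F.
  move=> a u v; rewrite /F scaler_sumr -big_split /=.
  by apply: eq_bigr => i _; rewrite linearPl /= scalerDl scalerA.
pose Fl : {linear L -> L} := HB.pack F (GRing.isLinear.Build _ _ _ _ F FL).
have coefE (c d : 'I_(\dim {:L}) -> R) :
    \sum_i c i *: b`_i = \sum_i d i *: b`_i -> c =1 d.
  move=> cd i.
  rewrite -(coord_sum_free c i (basis_free bP)).
  by rewrite -(coord_sum_free d i (basis_free bP)) cd.
have ext (u : {scalar L}) (v : {scalar L}) :
    (forall i : 'I_(\dim {:L}), u b`_i = v b`_i) -> u =1 v.
  move=> uv z; rewrite (coord_basis bP (memvf z)) !linear_sum.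
  by apply: eq_bigr => i _; rewrite !linearZ /= uv.
have kF : lker (linfun Fl) == 0%VS.
  apply/lker0P => u v; rewrite !lfunE /= => /coefE uv.
  by apply: dot_inj; exact: (ext (g u) (g v)).
exists ((linfun Fl)^-1%VF (\sum_(i < \dim {:L}) f b`_i *: b`_i)).
set w := _ (\sum_(i < _) _).
apply: (ext (g w)); apply: coefE.
have := lker0_lfunVK kF (\sum_(i < \dim {:L}) f b`_i *: b`_i).
by rewrite -/w lfunE.
Qed.

Lemma levi_civitaP (x y z : L) : 2 * g (levi_civita x y) z = koszul x y z.
Proof.
rewrite /levi_civita; case: xgetP => [w _ /(_ z)//|noW]; exfalso.
pose K z := 2^-1 * koszul x y z.
have KL : scalar K.
  move=> a u v; rewrite /K /koszul !(linearPl, linearPr) /=.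
  by rewrite /=; ring.
pose Kl : {scalar L} := HB.pack K (GRing.isLinear.Build _ _ _ _ K KL).
have [w wK] := dot_riesz Kl.
by apply: (noW w) => t; rewrite wK /= /K mulVKf// pnatr_eq0.
Qed.

Lemma levi_civita_unique (x y w : L) :
  (forall z, 2 * g w z = koszul x y z) -> w = levi_civita x y.
Proof.
move=> wP; apply: dot_inj => z.
by apply: (@mulfI _ 2); [rewrite pnatr_eq0 | rewrite wP levi_civitaP].
Qed.

Fact levi_civita_linearl y : linear (levi_civita ^~ y).
Proof.
move=> a u v; apply/esym/levi_civita_unique => z.
rewrite linearPl /= mulrDr mulrCA !levi_civitaP /koszul.
by rewrite !(linearPl, linearPr) /=; ring.
Qed.

Fact levi_civita_linearr x : linear (levi_civita x).
Proof.
move=> a u v; apply/esym/levi_civita_unique => z.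
rewrite linearPl /= mulrDr mulrCA !levi_civitaP /koszul.
by rewrite !(linearPl, linearPr) /=; ring.
Qed.

HB.instance Definition _ := bilinear_isBilinear.Build R L L L *:%R *:%R
  levi_civita (levi_civita_linearl, levi_civita_linearr).

End LeviCivita.

Definition filiform (R : fieldType) (n : nat) : Type := 'rV[R]_n.

HB.instance Definition _ (R : fieldType) (n : nat) :=
  Vector.copy (filiform R n) 'rV[R]_n.

Section Filiform.
Variables (R : fieldType) (n : nat).
Implicit Types x y z : filiform R n.

(* Indices are 1-based: filiform_X 1, ..., filiform_X n are the standard basis
   vectors and filiform_X i is 0 for every other i; filiform_coord i is the
   coordinate along filiform_X i (and 0 if there is no such basis vector). *)
Definition filiform_X (i : nat) : filiform R n := \row_(j < n) (j.+1 == i)%:R.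

Definition filiform_coord (i : nat) (x : filiform R n) : R :=
  \sum_(j < n | j.+1 == i) (x : 'rV[R]_n) 0 j.

(* The bilinear alternating extension of [X_1, X_i] = X_(i+1), 2 <= i < n. *)
Definition filiform_lie x y : filiform R n :=
  \sum_(2 <= i < n)
    (filiform_coord 1 x * filiform_coord i y
     - filiform_coord i x * filiform_coord 1 y) *: filiform_X i.+1.

Fact filiform_coord_linear i : scalar (filiform_coord i).
Proof.
move=> a u v; rewrite /filiform_coord mulr_sumr -big_split /=.
by apply: eq_bigr => j _; rewrite !mxE.
Qed.

HB.instance Definition _ i := GRing.isLinear.Build R (filiform R n) R *%R
  (filiform_coord i) (filiform_coord_linear i).

Lemma filiform_coordX i j :
  filiform_coord i (filiform_X j) = ((i == j) && (0 < i <= n)%N)%:R.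
Proof.
rewrite /filiform_coord.
case: (boolP (0 < i <= n)%N) => [/andP[i0 lein]|iN]; last first.
  rewrite andbF big1// => k /eqP ki; case/negP: iN.
  by rewrite -ki /= ltn_ord.
have lti : (i.-1 < n)%N by rewrite prednK.
rewrite (big_pred1 (Ordinal lti)) => [|k].
  by rewrite /filiform_X mxE /= prednK// andbT.
by rewrite /= -val_eqE /= -[RHS]eqSS prednK.
Qed.

Fact filiform_lieC x y : filiform_lie y x = - filiform_lie x y.
Proof.
rewrite /filiform_lie -sumrN; apply: eq_bigr => i _.
by rewrite -scaleNr opprB; congr (_ *: _); congr (_ - _); rewrite mulrC.
Qed.

Fact filiform_lie_linearr x : linear (filiform_lie x).
Proof.
move=> a u v; rewrite /filiform_lie scaler_sumr -big_split /=.
apply: eq_bigr => i _; rewrite !linearP /= scalerA -scalerDl.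
by congr (_ *: _); ring.
Qed.

Fact filiform_lie_linearl y : linear (filiform_lie ^~ y).
Proof.
move=> a u v /=.
by rewrite !(filiform_lieC y) filiform_lie_linearr opprD scalerN.
Qed.

Fact filiform_lie_alternating x : filiform_lie x x = 0.
Proof.
by rewrite /filiform_lie big1// => i _; rewrite mulrC subrr scale0r.
Qed.

Lemma filiform_coord1_lie x y : filiform_coord 1 (filiform_lie x y) = 0.
Proof.
rewrite /filiform_lie linear_sum big_nat big1//= => i /andP[i2 _].
by rewrite linearZ /= filiform_coordX; case: i i2 => //= i; rewrite mulr0.
Qed.

Definition filiform_shift x : filiform R n :=
  \sum_(2 <= i < n) filiform_coord i x *: filiform_X i.+1.

Fact filiform_lieE x y :
  filiform_lie x y = filiform_coord 1 x *: filiform_shift y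
                     - filiform_coord 1 y *: filiform_shift x.
Proof.
rewrite /filiform_lie /filiform_shift !scaler_sumr -sumrB.
apply: eq_bigr => i _; rewrite !scalerA -scalerBl; congr (_ *: _).
by congr (_ - _); rewrite mulrC.
Qed.

Fact filiform_shift_linear : linear filiform_shift.
Proof.
move=> a u v; rewrite /filiform_shift scaler_sumr -big_split /=.
by apply: eq_bigr => i _; rewrite linearP /= scalerA scalerDl.
Qed.

HB.instance Definition _ := GRing.isLinear.Build R (filiform R n)
  (filiform R n) *:%R filiform_shift filiform_shift_linear.

Fact filiform_lie_jacobi x y z :
  filiform_lie x (filiform_lie y z) + filiform_lie y (filiform_lie z x)
  + filiform_lie z (filiform_lie x y) = 0.
Proof.
rewrite !(filiform_lieE _ (filiform_lie _ _)) !filiform_coord1_lie.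
rewrite !scale0r !subr0 !filiform_lieE !linearB !linearZ /=.
rewrite !scalerA !scalerN.
rewrite (mulrC (_ y) (_ x)) (mulrC (_ z) (_ x)) (mulrC (_ z) (_ y)).
by rewrite addrAC subrKA subrKA subrr.
Qed.

HB.instance Definition _ := Vector_isLieAlgebra.Build R (filiform R n)
  filiform_lie_linearl filiform_lie_linearr
  filiform_lie_alternating filiform_lie_jacobi.

Lemma filiform_lie_X1X i : (2 <= i < n)%N ->
  lie (filiform_X 1) (filiform_X i) = filiform_X i.+1.
Proof.
move=> /andP[i2 ltin]; rewrite [LHS]filiform_lieE !filiform_coordX.
have n0 : (0 < n)%N by apply: leq_ltn_trans ltin.
rewrite eqxx n0 scale1r (ltn_eqF i2) scale0r subr0.
rewrite /filiform_shift (bigD1_seq i) ?mem_index_iota ?i2 ?iota_uniq//=.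
rewrite filiform_coordX eqxx (ltnW ltin) (ltnW i2) scale1r big1 ?addr0//.
by move=> j ji; rewrite filiform_coordX (negbTE ji) scale0r.
Qed.

Lemma filiform_lie_X1Xn : lie (filiform_X 1) (filiform_X n) = 0.
Proof.
have [n1|n1] := eqVneq 1%N n.
  have -> : filiform_X n = filiform_X 1 by congr filiform_X.
  exact: lie_alternating.
rewrite [LHS]filiform_lieE !filiform_coordX (negbTE n1).
rewrite scale0r subr0 /filiform_shift big_nat big1 ?scaler0// => i /andP[_ ltin].
by rewrite filiform_coordX (ltn_eqF ltin) scale0r.
Qed.

Lemma filiform_lie_XX i j : (2 <= i)%N -> (2 <= j)%N ->
  lie (filiform_X i) (filiform_X j) = 0.
Proof.
move=> i2 j2; rewrite [LHS]filiform_lieE !filiform_coordX.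
by rewrite !ltn_eqF// !scale0r subrr.
Qed.

Lemma filiform_dim : \dim {: filiform R n} = n.
Proof. by rewrite dimvf /dim /= mul1n. Qed.

Lemma filiform_basis :
  basis_of {: filiform R n} [tuple filiform_X i.+1 | i < n].
Proof.
rewrite basisEfree subvf size_tuple filiform_dim leqnn !andbT.
apply/freeP => k k0 i.
have /(congr1 (filiform_coord i.+1)) := k0.
rewrite linear0 linear_sum (bigD1 i)//= big1 ?addr0 => [|j ji].
  rewrite linearZ /= (nth_map i) ?size_enum_ord// nth_ord_enum.
  by rewrite filiform_coordX eqxx ltn_ord mulr1.
rewrite linearZ /= (nth_map i) ?size_enum_ord// nth_ord_enum filiform_coordX.
by rewrite eqSS eq_sym val_eqE (negbTE ji) mulr0.
Qed.

End Filiform.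

(* Main.v *)
From HB Require Import structures.
Require Import Defs.
From mathcomp Require Import all_boot all_order all_algebra.
From mathcomp Require Import reals.
From mathcomp Require Import ring.
Local Open Scope ring_scope.

(** The hyperplane of L_n complementary to X_1 is the abelian ideal
    V = <X_2, ..., X_n>, on which D = ad X_1 is a nilpotent shift.  The
    codimension two subalgebra is h = <X_2, ..., X_(n-1)>.  Since h lies in V,
    all brackets between elements of h vanish, and for Y, Z in h and any W the
    Koszul formula reduces to
<<
      2 <nabla_Y Z, W> = c (<D Y, Z> + <D Z, Y>),
>>
    where c is the X_1-coordinate of W.  So it is enough to find an inner
    product for which D is skew on h; then nabla vanishes identically on h.

    Encode X_(j+1) as the monomial t^j, so that L_n is the space of
    polynomials of degree less than n.  On h (polynomials of degree less than
    n - 1 without constant term) D is multiplication by t, without truncation: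
    that is why X_n is left out of h.  Multiplication by t is skew for any
    L^2 inner product over a measure carried by the imaginary axis, because
    t is purely imaginary there.  Taking a positive mass at each
    point i w with w an integer, |w| < n, equal at w and -w, gives a positive
    definite form, as a nonzero polynomial of degree less than n cannot vanish
    at all of these points.

    To stay over the real numbers, f(i w) is replaced by the real number
    Re f(i w) + Im f(i w), i.e. the monomial t^j is evaluated as
    (Re i^j + Im i^j) w^j = (-1)^(j(j-1)/2) w^j.  Real and imaginary parts have
    opposite parities in w, so by symmetry of the masses this does not change the
    inner product.  Multiplication by t becomes the operator
    T(w) |-> w T(-w) (filiform_poly_shift), and skewness becomes the cancellation
    of the contributions of w and -w (filiform_dot_shift). *)

Set Implicit Arguments.
Unset Strict Implicit.
Unset Printing Implicit Defensive.

Import Order.TTheory GRing.Theory Num.Theory.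

Lemma filiform_coord_shift (R : fieldType) (n i : nat) (x : filiform R n) :
  (0 < i < n)%N -> filiform_coord 1 x = 0 ->
  filiform_coord i.+1 (filiform_shift x) = filiform_coord i x.
Proof.
move=> /andP[i0 ltin] x1; rewrite /filiform_shift linear_sum /=.
under eq_bigr => j _ do rewrite linearZ /= filiform_coordX eqSS ltin andbT.
have [->|i1] := eqVneq i 1%N.
  rewrite x1 big_nat big1// => j /andP[j2 _].
  by rewrite ltn_eqF// mulr0.
have i2 : (2 <= i)%N by rewrite ltn_neqAle eq_sym i1.
rewrite (bigD1_seq i) ?mem_index_iota ?i2 ?iota_uniq//= eqxx mulr1.
by rewrite big1 ?addr0// => j ji; rewrite eq_sym (negbTE ji) mulr0.
Qed.

Section FlatSubalgebra.
Variables (R : realFieldType) (n : nat).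
Implicit Types x y z : filiform R n.

(** The sign is Re i^j + Im i^j, see above. *)
Definition filiform_poly x : {poly R} :=
  \poly_(j < n) ((-1) ^+ 'C(j, 2) * filiform_coord j.+1 x).

Fact filiform_poly_linear : linear filiform_poly.
Proof.
move=> a u v; apply/polyP => j; rewrite coefD coefZ !coef_poly.
by case: ltnP => _; rewrite ?mulr0 ?addr0// linearP /=; ring.
Qed.

HB.instance Definition _ := GRing.isLinear.Build R (filiform R n) {poly R}
  *:%R filiform_poly filiform_poly_linear.

Lemma filiform_poly_inj : injective filiform_poly.
Proof.
apply: raddf_inj => x x0; apply/rowP => j; rewrite mxE.
have := congr1 (fun p : {poly R} => p`_j) x0.
rewrite coef_poly ltn_ord coef0 => /eqP.
rewrite mulf_eq0 signr_eq0 /= /filiform_coord => /eqP.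
by rewrite (big_pred1 j).
Qed.

(** Consecutive signs differ by the factor (-1)^j, which is what turns w into
    -w; the vanishing of the last coordinate makes the degree bound harmless. *)
Lemma filiform_poly_shift x w :
    filiform_coord 1 x = 0 -> filiform_coord n x = 0 ->
  (filiform_poly (filiform_shift x)).[w] = w * (filiform_poly x).[- w].
Proof.
move=> x1 xn; rewrite !horner_poly.
have D1 : filiform_coord 1 (filiform_shift x) = 0.
  rewrite /filiform_shift linear_sum big_nat big1//= => i /andP[i2 _].
  by rewrite linearZ /= filiform_coordX; case: i i2 => //= i; rewrite mulr0.
case: n x x1 xn D1 => [|m] x x1 xn D1; first by rewrite !big_ord0 mulr0.
rewrite big_ord_recl D1 mulr0 mul0r add0r.
rewrite [in RHS]big_ord_recr /= xn mulr0 mul0r addr0.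
rewrite mulr_sumr; apply: eq_bigr => j _.
rewrite /bump /= add1n filiform_coord_shift ?ltnS ?ltn_ord// binS bin1 exprD.
by rewrite (exprNn w) exprS; ring.
Qed.

Definition filiform_dot x y : R :=
  \sum_(k < n) ((filiform_poly x).[k%:R] * (filiform_poly y).[k%:R]
                + (filiform_poly x).[- k%:R] * (filiform_poly y).[- k%:R]).

Fact filiform_dotC x y : filiform_dot x y = filiform_dot y x.
Proof. by apply: eq_bigr => k _; ring. Qed.

Fact filiform_dot_linearr x : scalar (filiform_dot x).
Proof.
move=> a u v; rewrite /filiform_dot mulr_sumr -big_split /=.
by apply: eq_bigr => k _; rewrite linearP /= !(hornerD, hornerZ); ring.
Qed.

Fact filiform_dot_linearl y : scalar (filiform_dot ^~ y).
Proof.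
by move=> a u v /=; rewrite !(filiform_dotC _ y) filiform_dot_linearr.
Qed.

HB.instance Definition _ :=
  bilinear_isBilinear.Build R (filiform R n) (filiform R n) R
    *%R (idfun \; *%R) filiform_dot
    (filiform_dot_linearl, filiform_dot_linearr).

Fact filiform_dot_hermitian x y :
  filiform_dot x y = (-1) ^+ false * idfun (filiform_dot y x).
Proof. by rewrite expr0 mul1r filiform_dotC. Qed.

HB.instance Definition _ := isHermitianSesquilinear.Build R (filiform R n)
  false idfun filiform_dot filiform_dot_hermitian.

Fact filiform_dot_gt0 x : x != 0 -> 0 < filiform_dot x x.
Proof.
have ge0 k : 0 <= (filiform_poly x).[k%:R] * (filiform_poly x).[k%:R]
                  + (filiform_poly x).[- k%:R] * (filiform_poly x).[- k%:R].
  by rewrite addr_ge0// -expr2 sqr_ge0.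
move=> xN0; rewrite lt0r sumr_ge0 ?andbT//.
apply: contra xN0 => /eqP /psumr_eq0P gx0; apply/eqP.
apply: filiform_poly_inj; rewrite linear0.
apply: (@roots_geq_poly_eq0 _ _ [seq k%:R | k <- iota 0 n]).
- apply/allP => _ /mapP[k + ->]; rewrite mem_iota => /= kn.
  have /eqP := gx0 (fun k _ => ge0 k) (Ordinal kn) isT.
  rewrite paddr_eq0 -?expr2 ?sqr_ge0// => /andP[+ _].
  by rewrite sqrf_eq0.
- by rewrite map_inj_uniq ?iota_uniq//; exact: mulrIn (oner_neq0 R).
- by rewrite size_map size_iota size_poly.
Qed.

HB.instance Definition _ := isDotProduct.Build R (filiform R n) filiform_dot
  filiform_dot_gt0.

Lemma filiform_dot_shift x y :
    filiform_coord 1 x = 0 -> filiform_coord n x = 0 ->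
    filiform_coord 1 y = 0 -> filiform_coord n y = 0 ->
  filiform_dot (filiform_shift x) y + filiform_dot (filiform_shift y) x = 0.
Proof.
move=> x1 xn y1 yn; rewrite /filiform_dot -big_split big1//= => k _.
by rewrite !filiform_poly_shift// opprK; ring.
Qed.

Lemma levi_civita_filiform0 x y :
    filiform_coord 1 x = 0 -> filiform_coord n x = 0 ->
    filiform_coord 1 y = 0 -> filiform_coord n y = 0 ->
  levi_civita filiform_dot x y = 0.
Proof.
move=> x1 xn y1 yn; apply/esym/levi_civita_unique => z.
rewrite linear0l mulr0 /koszul.
have lieE u v : lie u v = filiform_coord 1 u *: filiform_shift v
                          - filiform_coord 1 v *: filiform_shift u.
  exact: filiform_lieE.
rewrite !lieE x1 y1 !scale0r !subr0 linear0l add0r !linearZl_LR /=.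
by rewrite -mulrDr filiform_dot_shift// mulr0.
Qed.

Definition filiform_ends x : R^o * R^o :=
  (filiform_coord 1 x, filiform_coord n x).

Fact filiform_ends_linear : linear filiform_ends.
Proof. by move=> a u v; rewrite /filiform_ends !linearP. Qed.

HB.instance Definition _ := GRing.isLinear.Build R (filiform R n)
  (R^o * R^o)%type *:%R filiform_ends filiform_ends_linear.

(** The span of X_2, ..., X_(n-1), given by its equations. *)
Definition filiform_middle : {vspace filiform R n} :=
  lker (linfun filiform_ends).

Lemma filiform_middleP x :
  reflect (filiform_coord 1 x = 0 /\ filiform_coord n x = 0)
          (x \in filiform_middle).
Proof.
rewrite memv_ker lfunE; apply: (iffP eqP) => [[-> ->]//|[x1 xn]].
by rewrite /= /filiform_ends x1 xn.
Qed.

Lemma dim_filiform_middle : (2 <= n)%N ->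
  (\dim filiform_middle + 2 = \dim {: filiform R n})%N.
Proof.
move=> n2; rewrite -(limg_ker_dim (linfun filiform_ends) fullv) capfv.
have n1 : n == 1%N = false by rewrite gtn_eqF.
have n0 : (0 < n)%N by apply: ltnW.
suff -> : limg (linfun filiform_ends) = fullv by rewrite dimvf.
apply/eqP; rewrite eqEsubv subvf; apply/subvP => -[a b] _.
apply/memv_imgP; exists (a *: filiform_X R n 1 + b *: filiform_X R n n).
  exact: memvf.
rewrite lfunE /= /filiform_ends !linearD !linearZ /= !filiform_coordX.
by rewrite !eqxx n1 (eq_sym 1%N) n1 n0 !leqnn !mulr1 !mulr0 addr0 add0r.
Qed.

End FlatSubalgebra.

Theorem theorem1p17 (R : realType) (n : nat) (hn : (3 <= n)%N) :
  exists (g : {dot (filiform R n) for idfun}) (h : {vspace filiform R n}),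
    [/\ is_subalgebra h,
        totally_geodesic g h
      & (\dim h + 2 = \dim {: filiform R n})%N].
Proof.
exists (@filiform_dot R n), (filiform_middle R n); split.
- move=> x y /filiform_middleP[x1 _] /filiform_middleP[y1 _].
  by rewrite [lie _ _]filiform_lieE x1 y1 !scale0r subr0 mem0v.
- move=> x y /filiform_middleP[x1 xn] /filiform_middleP[y1 yn].
  by rewrite levi_civita_filiform0// mem0v.
- exact: dim_filiform_middle (ltnW hn).
Qed.
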